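(* Let $H\ne\{1\}$ be a reduced atomic unit-cancellative monoid and suppose that at least one of the following holds: (a) $H$ is finitely presented and there is $L\in\mathcal L(H)$ with $\rho(L)=\rho(H)<\infty$; (b) $H$ is cancellative and its monoid of relations $\sim_H$ is finitely generated; (c) $H$ is commutative and finitely generated. Then there is $M\in\mathbb N$ such that $\rho_k(H)-\rho_{k-1}(H)\le M$ for all $k\ge2$, and $\mathcal L(H)$ satisfies the Structure Theorem for Unions.
   Context: Monoid = associative semigroup with identity; reduced means the only unit is $1$; unit-cancellative means $a=au$ or $a=ua$ implies $u$ is a unit; atomic means every non-unit is a finite product of atoms. $\mathsf Z(H)$ is the free monoid on the atoms $\mathcal A(H)$ (free abelian if $H$ commutative), $\pi:\mathsf Z(H)\to H$ the canonical epimorphism, $\sim_H=\{(x,y)\mid\pi(x)=\pi(y)\}$. $H$ is finitely presented if $\mathcal A(H)$ is finite and some finite subset of $\sim_H$ generates $\sim_H$ as a congruence on $\mathsf Z(H)$. $\mathsf L(a)$ is the set of $k$ with $a$ a product of $k$ atoms ($\mathsf L(1)=\{0\}$), $\mathcal L(H)=\{\mathsf L(a)\}$. $\rho(L)=\sup(L\cap\mathbb N)/\min(L\cap\mathbb N)$ (or $1$ if $L\cap\mathbb N=\emptyset$), $\rho(H)=\sup_{L\in\mathcal L(H)}\rho(L)$; $\mathcal U_k(H)=\bigcup\{L\in\mathcal L(H)\mid k\in L\}$, $\rho_k(H)=\sup\mathcal U_k(H)$. A nonempty $L\subset\mathbb N_0$ is an almost arithmetical progression (AAP) with difference $d\in\mathbb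 N$ and bound $M\in\mathbb N_0$ if $L\subset\min L+d\mathbb Z$ and $L\cap[\min L+M,\sup L-M]$ is a nonempty arithmetical progression with difference $d$ (where $[\min L+M,\sup L-M]$ means $\mathbb N_{\ge \min L+M}$ if $L$ is infinite). $\mathcal L(H)$ satisfies the Structure Theorem for Unions if there are $d\in\mathbb N$, $M\in\mathbb N_0$ such that $\mathcal U_k(H)$ is an AAP with difference $d$ and bound $M$ for all sufficiently large $k$. *)

(* Defs.v *)
From HB Require Import structures.
From mathcomp Require Import all_boot all_order all_algebra.
From Stdlib Require Import ClassicalEpsilon Permutation.
From Stdlib Require List.

Set Implicit Arguments.
Unset Strict Implicit.
Unset Printing Implicit Defensive.

(* [None] stands for ∞. *)

Definition upper_bound (S : nat -> Prop) (b : nat) : Prop :=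
  forall n, S n -> (n <= b)%N.

(* sup of a subset of N_0 in N_0 ∪ {∞} (sup ∅ = 0) *)
Definition esup (S : nat -> Prop) : option nat :=
  match excluded_middle_informative (exists b, upper_bound S b) with
  | left _ => Some (epsilon (inhabits 0%N)
                 (fun b => upper_bound S b /\ forall c, upper_bound S c -> (b <= c)%N))
  | right _ => None
  end.

Definition emin (S : nat -> Prop) : nat :=
  epsilon (inhabits 0%N) (fun m => S m /\ forall n, S n -> (m <= n)%N).

Definition ele (x y : option nat) : Prop :=
  match x, y with
  | _, None => True
  | None, Some _ => False
  | Some a, Some b => is_true (a <= b)%N
  end.

Definition eadd (x : option nat) (M : nat) : option nat :=
  match x with Some a => Some (a + M)%N | None => None end.

Definition ele_rat (x y : option rat) : Prop :=
  match x, y with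
  | _, None => True
  | None, Some _ => False
  | Some a, Some b => is_true (a <= b)%R
  end.

Definition rhoL (L : nat -> Prop) : option rat :=
  let Lp := fun n => L n /\ (0 < n)%N in
  match excluded_middle_informative (exists n, Lp n) with
  | right _ => Some 1%R
  | left _ =>
      match esup Lp with
      | None => None
      | Some s => Some ((s%:R / (emin Lp)%:R)%R : rat)
      end
  end.

Definition AP (P : nat -> Prop) (d : nat) : Prop :=
  exists a,
    (exists l, forall n, P n <-> exists nu, (nu <= l)%N /\ n = (a + nu * d)%N)
    \/ (forall n, P n <-> exists nu, n = (a + nu * d)%N).

Definition is_min (P : nat -> Prop) (m : nat) : Prop :=
  P m /\ forall n, P n -> (m <= n)%N.
Definition is_max (P : nat -> Prop) (s : nat) : Prop :=
  P s /\ forall n, P n -> (n <= s)%N.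

(* L is an AAP with difference d and bound M.  The interval
   [min L + M, sup L - M] is { n | min L + M <= n and n + M <= max L }
   (which is N_{>= min L + M} when L is infinite, i.e. has no max). *)
Definition AAP (L : nat -> Prop) (d M : nat) : Prop :=
  exists m, is_min L m /\
    (forall n, L n -> (d %| (n - m))%N) /\
    AP (fun n => L n /\ (m + M <= n)%N /\ (forall s, is_max L s -> (n + M <= s)%N)) d.

Section Monoid.
Variables (H : Type) (mul : H -> H -> H) (one : H).

Definition is_monoid : Prop :=
  (forall a b c, mul a (mul b c) = mul (mul a b) c) /\
  (forall a, mul one a = a) /\ (forall a, mul a one = a).

Definition is_unit (u : H) : Prop := exists v, mul u v = one /\ mul v u = one.

Definition reduced : Prop := forall u, is_unit u -> u = one.

Definition unit_cancellative : Prop :=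
  forall a u, (a = mul a u \/ a = mul u a) -> is_unit u.

Definition cancellative : Prop :=
  forall a b c, (mul a b = mul a c -> b = c) /\ (mul b a = mul c a -> b = c).

Definition comm_monoid : Prop := forall a b, mul a b = mul b a.

Definition is_atom (a : H) : Prop :=
  ~ is_unit a /\ forall b c, a = mul b c -> is_unit b \/ is_unit c.

Definition prodH (s : list H) : H := List.fold_right mul one s.

Definition factz (s : list H) : Prop := List.Forall is_atom s.

Definition atomic : Prop :=
  forall a, ~ is_unit a -> exists s, s <> nil /\ factz s /\ prodH s = a.

Definition Lset (a : H) (k : nat) : Prop :=
  exists s, factz s /\ size s = k /\ prodH s = a.

Definition Uk (k : nat) (n : nat) : Prop := exists a, Lset a k /\ Lset a n.

Definition rho_k (k : nat) : option nat := esup (Uk k).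

(* There is L in L(H) with rho(L) = rho(H) < ∞, where
   rho(H) = sup_{a in H} rho(L(a)). *)
Definition elasticity_accepted_finite : Prop :=
  exists a q, rhoL (Lset a) = Some q /\ forall b, ele_rat (rhoL (Lset b)) (Some q).

(* Z(H): the free monoid on atoms, or the free abelian monoid when H is
   commutative (modelled as words modulo permutation). *)
(* congruence on Z(H) generated by R; [ab] : H is commutative *)
Inductive cong_gen (ab : Prop) (R : list (list H * list H)) : list H -> list H -> Prop :=
  | cg_base x y : List.In (x, y) R -> cong_gen ab R x y
  | cg_refl x : factz x -> cong_gen ab R x x
  | cg_perm x y : ab -> factz x -> Permutation x y -> cong_gen ab R x y
  | cg_sym x y : cong_gen ab R x y -> cong_gen ab R y x
  | cg_trans x y z : cong_gen ab R x y -> cong_gen ab R y z -> cong_gen ab R x z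
  | cg_ctx u x y v : factz u -> factz v -> cong_gen ab R x y ->
      cong_gen ab R (u ++ x ++ v) (u ++ y ++ v).

Definition in_sim (p : list H * list H) : Prop :=
  factz p.1 /\ factz p.2 /\ prodH p.1 = prodH p.2.

Definition fin_presented : Prop :=
  (exists As : list H, forall a, is_atom a <-> List.In a As) /\
  exists R : list (list H * list H),
    List.Forall in_sim R /\
    forall x y, factz x -> factz y -> prodH x = prodH y -> cong_gen comm_monoid R x y.

(* the monoid of relations ~_H (a submonoid of Z(H) x Z(H)) is finitely
   generated; equality in Z(H) is equality of words, or of words up to
   permutation when H is commutative *)
Definition Zeq (x y : list H) : Prop :=
  (comm_monoid -> Permutation x y) /\ (~ comm_monoid -> x = y).

Definition relations_fin_gen : Prop :=
  exists G : list (list H * list H),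
    List.Forall in_sim G /\
    forall x y, in_sim (x, y) ->
      exists s : list (list H * list H),
        List.Forall (fun g => List.In g G) s /\
        Zeq x (List.concat (List.map fst s)) /\ Zeq y (List.concat (List.map snd s)).

Definition fin_generated : Prop :=
  exists gens : list H, forall a, exists s,
    List.Forall (fun g => List.In g gens) s /\ prodH s = a.

Definition structure_thm_unions : Prop :=
  exists d M k0 : nat, (0 < d)%N /\ forall k, (k0 <= k)%N -> AAP (Uk k) d M.

End Monoid.

(* Main.v *)
Require Import Defs.
From HB Require Import structures.
From mathcomp Require Import all_boot all_order all_algebra.
From mathcomp Require Import zify.
From Stdlib Require Import Classical ClassicalEpsilon Permutation.
From Stdlib Require List.

Set Implicit Arguments.
Unset Strict Implicit.
Unset Printing Implicit Defensive.

Import Order.TTheory GRing.Theory Num.Theory.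

(** Unions of sets of lengths are symmetric ([l] is in [U k] iff [k] is in [U l])
    and superadditive ([U k + U l] is contained in [U (k + l)]).  If every
    [rho k = max (U k)] is finite and [rho k - rho (k - 1)] is bounded, then the
    elements [rho (k - j) + j] of [U k] leave only bounded gaps above [k].  Adding a
    long arithmetical progression [{K + j d}] contained in some [U K], where [d] is the
    least positive difference of two lengths of one element, fills these gaps up to a
    bounded distance from [rho k]; the part below [k] follows by symmetry.  So the
    Structure Theorem reduces to bounding [rho k - rho (k - 1)].

    An accepted elasticity [n / m] gives [rho k <= k n / m], which is attained up to a
    constant by powers; when the monoid of relations is finitely generated, the
    elasticity is attained at a generator.

    In the finitely generated commutative case the elasticity need not be accepted
    (for instance in [<u, v, c | v c = u^2 c>]).  If [rho k - rho (k - 1)] were unbounded,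
    Dickson's lemma would give an increasing sequence of extremal pairs [(x t, y t)] of
    exponent vectors.  By Redei's theorem the congruences [x t + r ~ x t + r'] are
    constant from some [t = i] on, so for [i < j < t] one may replace the part
    [(x j, y j)] of [(x t, y t)] by [(x i, y i)].  This changes both lengths by amounts
    independent of [t], which is a contradiction. *)

(** * Choice, minima and suprema for sets of natural numbers *)

Lemma functional_choice (A B : Type) (R : A -> B -> Prop) :
  (forall x, exists y, R x y) -> exists f, forall x, R x (f x).
Proof.
move=> h; exists (fun x => sval (constructive_indefinite_description _ (h x))).
by move=> x; case: constructive_indefinite_description.
Qed.

Lemma ex_is_min (P : nat -> Prop) : (exists n, P n) -> exists m, is_min P m.
Proof.
case=> n; elim/ltn_ind: n => n IHn Pn.
case: (classic (exists2 k, k < n & P k)) => [[k lt_kn Pk]|noP]; first exact: IHn Pk.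
by exists n; split=> // k Pk; rewrite leqNgt; apply/negP => lt_kn; apply: noP; exists k.
Qed.

Lemma ex_is_max (P : nat -> Prop) b :
  (exists n, P n) -> upper_bound P b -> exists s, is_max P s.
Proof.
move=> [n Pn] ubP.
have [|c [ubc minc]] := @ex_is_min (upper_bound P); first by exists b.
exists c; split=> //; apply: NNPP => nPc.
have := ubc _ Pn; case: c => [|c] in ubc minc nPc * => le_nc.
  by apply: nPc; case: n le_nc Pn.
suff /minc : upper_bound P c by rewrite ltnn.
move=> k Pk; have := ubc _ Pk; rewrite leq_eqVlt => /orP[/eqP ek|//].
by case: nPc; rewrite -ek.
Qed.

Lemma esup_is_max (P : nat -> Prop) s : is_max P s -> esup P = Some s.
Proof.
move=> [Ps ubs]; rewrite /esup; case: excluded_middle_informative => [?|[]]; last by exists s.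
have := epsilon_spec (inhabits 0)
  (fun b => upper_bound P b /\ forall c, upper_bound P c -> b <= c).
case=> [|ub le]; first by exists s; split=> // c; apply.
by congr Some; apply/eqP; rewrite eqn_leq le //= ub.
Qed.

Lemma esup_upper (P : nat -> Prop) s : esup P = Some s -> upper_bound P s.
Proof.
rewrite /esup; case: excluded_middle_informative => [exb [<-]|//].
have [b [ub minb]] := ex_is_min exb.
by case: (epsilon_spec (inhabits 0)
  (fun b => upper_bound P b /\ forall c, upper_bound P c -> b <= c)); first by exists b.
Qed.

Lemma emin_is_min (P : nat -> Prop) m : is_min P m -> emin P = m.
Proof.
move=> mP; have [Pm minm] := mP.
have [Pe mine] := epsilon_spec (inhabits 0) (is_min P) (ex_intro _ m mP).
by apply/eqP; rewrite eqn_leq mine //= minm.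
Qed.

(** * Unions of sets of lengths *)

Section Unions.
Variables (U : nat -> nat -> Prop) (rho : nat -> nat) (B : nat).
Hypothesis U_refl : forall k, U k k.
Hypothesis U_sym : forall k l, U k l -> U l k.
Hypothesis U_add : forall k l k' l', U k l -> U k' l' -> U (k + k') (l + l').
Hypothesis rhoP : forall k, is_max (U k) (rho k).
Hypothesis rho0 : rho 0 = 0.
Hypothesis rhoS : forall k, rho k.+1 <= rho k + B.

Lemma U_muln q k l : U k l -> U (q * k) (q * l).
Proof. by move=> Ukl; elim: q => [|q IHq]; rewrite ?mul0n // !mulSn; apply: U_add. Qed.

Lemma rho_addn k j : rho k + j <= rho (k + j).
Proof. by apply: (rhoP _).2; apply: U_add => //; apply: (rhoP k).1. Qed.

Lemma rho_addn_le k j : rho (k + j) <= rho k + j * B.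
Proof. by elim: j => [|j IHj]; rewrite ?addn0 // addnS; have := rhoS (k + j); lia. Qed.

Lemma U_ge_rho k l : U k l -> k <= rho l.
Proof. by move=> /U_sym; apply: (rhoP l).2. Qed.

(* Since [rho (k - j) + j] lies in [U k] for every [j], bounded growth of [rho]
   already bounds the gaps of [U k] above [k]. *)
Lemma U_dense k v : k <= v <= rho k -> exists2 u, U k u & u <= v <= u + B.
Proof.
elim: k v => [|k IHk] v /andP[le_kv le_v]; first by exists 0 => //; lia.
have [lt_v|le_v1] := ltnP (rho k).+1 v.
  exists (rho k).+1; last by have := rhoS k; lia.
  by rewrite -(addn1 k) -(addn1 (rho k)); apply: U_add => //; apply: (rhoP k).1.
case: v => // v in le_kv le_v le_v1 *.
have [|u Uku le_u] := IHk v; first by lia.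
by exists u.+1; [rewrite -(addn1 k) -(addn1 u); apply: U_add | lia].
Qed.

Section MinimalDistance.
Variables (X d : nat).
Hypothesis d_gt0 : 0 < d.
Hypothesis UXd : U X (X + d).
Hypothesis d_min : forall t x, 0 < t -> U x (x + t) -> d <= t.

(** Euclidean division: a remainder [r > 0] of [l - k] by [d] would be a smaller difference,
    obtained by adding to [(k, l)] the pair [(X + d, X)] taken [(l - k) %/ d] times. *)
Lemma U_dvdn_le k l : k <= l -> U k l -> d %| l - k.
Proof.
move=> le_kl Ukl; apply/eqP; case: (posnP ((l - k) %% d)) => // r_gt0.
have := ltn_pmod (l - k) d_gt0; rewrite ltnNge.
rewrite (@d_min _ ((l - k) %/ d * (X + d) + k)) //.
have -> : (l - k) %/ d * (X + d) + k + (l - k) %% d = (l - k) %/ d * X + l.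
  by have := divn_eq (l - k) d; rewrite mulnDr; lia.
by apply: U_add => //; apply: U_muln; apply: U_sym.
Qed.

Lemma U_eqmod k l : U k l -> l = k %[mod d].
Proof.
move=> Ukl; case/orP: (leq_total k l) => le; apply/eqP.
  by rewrite eqn_mod_dvd // U_dvdn_le.
by rewrite eq_sym eqn_mod_dvd // U_dvdn_le //; apply: U_sym.
Qed.

(** [U K] contains [K + j * d] for all [j <= B], enough steps to bridge a gap of length [B]; [C]
    bounds the growth of [rho] from [k - K] to [k]. *)
Let K := B * X.
Let C := K * B.

Lemma U_steps j : j <= B -> U K (K + j * d).
Proof.
move=> le_jB; have -> : K + j * d = j * (X + d) + (B - j) * X.
  by rewrite /K -{1}(subnKC le_jB) mulnDl mulnDr; lia.
rewrite /K -{1}(subnKC le_jB) mulnDl.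
by apply: U_add; apply: U_muln.
Qed.

(** [U_dense] gives [u] in [U (k - K)] at most [B] below [n - K]. The difference is some [j * d]
    with [j <= B], which [U_steps] supplies. *)
Lemma U_upper k n : K <= k -> k <= n -> n + C <= rho k -> n = k %[mod d] -> U k n.
Proof.
move=> le_Kk le_kn le_n eq_nk.
have le_rho : rho k <= rho (k - K) + C.
  by rewrite -{1}(subnK le_Kk); apply: rho_addn_le.
have [|u Uu le_u] := @U_dense (k - K) (n - K); first by lia.
have : d %| (n - K) - u.
  rewrite -eqn_mod_dvd; last by lia.
  rewrite (U_eqmod Uu) eqn_mod_dvd; last by lia.
  have -> : n - K - (k - K) = n - k by lia.
  by rewrite -eqn_mod_dvd //; apply/eqP.
case/dvdnP=> j def_j.
have le_jB : j <= B by have := leq_pmulr j d_gt0; lia.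
have -> : n = u + (K + j * d) by lia.
by rewrite -{1}(subnK le_Kk); apply: U_add => //; apply: U_steps.
Qed.

(** For [n < k] the roles are exchanged: [rho n >= rho m + (n - m) >= k + (n - m)], so [k] lies far
    enough below [rho n] for [U_upper]. *)
Lemma U_middle k m n : is_min (U k) m -> K <= k ->
  m + (C + K) <= n -> n + (C + K) <= rho k -> n = k %[mod d] -> U k n.
Proof.
move=> [Ukm _] le_Kk le_mn le_n eq_nk.
have [le_kn|lt_nk] := leqP k n; first by apply: U_upper => //; lia.
apply: U_sym; apply: U_upper; rewrite ?eq_nk; try lia.
have := rho_addn m (n - m); rewrite subnKC; last by lia.
by have := U_ge_rho Ukm; lia.
Qed.

Lemma AP_congruent_interval (P : nat -> Prop) k a b : a <= k <= b ->
  (forall n, P n <-> a <= n <= b /\ n = k %[mod d]) -> AP P d.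
Proof.
move=> /andP[le_ak le_kb] PE.
have [p pE] : exists p, forall j, (j <= p) = (j * d <= k - a).
  by exists ((k - a) %/ d) => j; apply: leq_divRL.
have [q qE] : exists q, forall j, (j <= q) = (j * d <= b - k).
  by exists ((b - k) %/ d) => j; apply: leq_divRL.
have le_p : p * d <= k - a by rewrite -pE.
have le_q : q * d <= b - k by rewrite -qE.
exists (k - p * d); left; exists (p + q) => n.
rewrite PE; split=> [[/andP[le_an le_nb] eq_nk]|[nu [le_nu ->]]]; last first.
  split.
    have : nu * d <= p * d + q * d by rewrite -mulnDl leq_mul2r le_nu orbT.
    by lia.
  rewrite -(modnMDl p k d) -(modnMDl p (_ + _) d) addnA subnKC; last by lia.
  by rewrite addnC modnMDl modnMDl.
have [le_kn|lt_nk] := leqP k n.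
  have /dvdnP[j def_j] : d %| n - k by rewrite -eqn_mod_dvd //; apply/eqP.
  exists (p + j); split; last by rewrite mulnDl; lia.
  by rewrite leq_add2l qE; lia.
have /dvdnP[j def_j] : d %| k - n.
  by rewrite -eqn_mod_dvd ?(ltnW lt_nk) // eq_sym; apply/eqP.
have le_jp : j <= p by rewrite pE; lia.
exists (p - j); split; first by lia.
have le_jpd : j * d <= p * d by rewrite leq_mul2r le_jp orbT.
by rewrite mulnBl; lia.
Qed.

Lemma U_AAP_min_distance : exists M k0, forall k, k0 <= k -> AAP (U k) d M.
Proof.
(* The threshold leaves room for [M] copies of [(X, X + d)] in either direction, so that
   [m + M <= k <= rho k - M] and the middle interval contains [k]. *)
pose M := C + K; exists M, (K + M * (X + d)) => k le_k.
have [|m mP] := @ex_is_min (U k); first by exists k.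
have [Ukm min_m] := mP.
have le_mM : m + M <= k.
  have : U k (k - M * d).
    have {2}-> : k = (k - M * (X + d)) + M * (X + d) by lia.
    have -> : k - M * (X + d) + M * (X + d) - M * d = (k - M * (X + d)) + M * X.
      by rewrite mulnDr; lia.
    have {1}-> : k = (k - M * (X + d)) + M * (X + d) by lia.
    by apply: U_add => //; apply: U_muln; apply: U_sym.
  by move/min_m; have := leq_pmulr M d_gt0; rewrite mulnDr in le_k; lia.
have le_rho : k + M <= rho k.
  have : U k (k + M * d).
    have {2}-> : k = (k - M * X) + M * X by rewrite mulnDr in le_k; lia.
    have {1}-> : k = (k - M * X) + M * X by rewrite mulnDr in le_k; lia.
    by rewrite -addnA -mulnDr; apply: U_add => //; apply: U_muln.
  by move/(rhoP k).2; have := leq_pmulr M d_gt0; lia.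
exists m; split=> //; split.
  by move=> n Ukn; rewrite -eqn_mod_dvd ?min_m // (U_eqmod Ukn) (U_eqmod Ukm).
apply: (@AP_congruent_interval _ k (m + M) (rho k - M)); first by lia.
move=> n; split=> [[Ukn [le_n le_max]]|[le_n eq_n]].
  by split; [have := le_max _ (rhoP k); lia | apply: U_eqmod].
split; last split; first by apply: (U_middle mP) => //; rewrite -/M; lia.
  by case/andP: le_n.
move=> s [_ max_s]; have := max_s _ (rhoP k).1; lia.
Qed.

End MinimalDistance.

Lemma U_AAP : exists d M k0, 0 < d /\ forall k, k0 <= k -> AAP (U k) d M.
Proof.
case: (classic (exists t, 0 < t /\ exists x, U x (x + t))) => [/ex_is_min|triv].
  case=> d [[d_gt0 [X UXd]] d_min].
  have [|M [k0 AAPk]] := @U_AAP_min_distance X d d_gt0 UXd; last by exists d, M, k0.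
  by move=> t x t_gt0 Uxt; apply: d_min; split=> //; exists x.
(* Here every [U k] is [{k}], an AAP with bound [0] for any difference. *)
have U_eq k l : U k l -> k = l.
  move=> Ukl; case: (ltngtP k l) => // lt; case: triv.
    by exists (l - k); rewrite subn_gt0; split=> //; exists k; rewrite subnKC // ltnW.
  by exists (k - l); rewrite subn_gt0; split=> //; exists l; rewrite subnKC; [apply: U_sym|apply: ltnW].
exists 1, 0, 0; split=> // k _; exists k; split.
  by split=> // n /U_eq->.
split=> [n /U_eq->|]; first by rewrite subnn.
exists k; left; exists 0 => n; split=> [[/U_eq<-]|[nu []]]; first by exists 0; split; lia.
rewrite leqn0 => /eqP-> ->; rewrite mul0n !addn0; split=> //; split=> // s [_].
by move=> /(_ k (U_refl k)); rewrite ?addn0.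
Qed.

End Unions.

(** * Congruences on [N^n] *)

Fixpoint vec (n : nat) : Type := if n is n'.+1 then (nat * vec n')%type else unit.

Fixpoint vadd {n} : vec n -> vec n -> vec n :=
  if n is n'.+1 then fun x y => (x.1 + y.1, vadd x.2 y.2) else fun _ _ => tt.

Fixpoint vzero {n} : vec n := if n is n'.+1 then (0, vzero) else tt.

Fixpoint vsize {n} : vec n -> nat :=
  if n is n'.+1 then fun x => x.1 + vsize x.2 else fun _ => 0.

Definition vle {n} (x y : vec n) : Prop := exists z, y = vadd x z.

Fixpoint vlex {n} : vec n -> vec n -> Prop :=
  if n is n'.+1 then fun x y => x.1 < y.1 \/ (x.1 = y.1 /\ vlex x.2 y.2)
  else fun _ _ => False.

Lemma vaddC n (x y : vec n) : vadd x y = vadd y x.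
Proof. by elim: n x y => //= n IHn x y; rewrite addnC IHn. Qed.

Lemma vaddA n (x y z : vec n) : vadd x (vadd y z) = vadd (vadd x y) z.
Proof. by elim: n x y z => //= n IHn x y z; rewrite addnA IHn. Qed.

Lemma vadd0 n (x : vec n) : vadd x vzero = x.
Proof. by elim: n x => [|n IHn] /= [] // a x; rewrite addn0 IHn. Qed.

Lemma vsizeD n (x y : vec n) : vsize (vadd x y) = vsize x + vsize y.
Proof. by elim: n x y => //= n IHn x y; rewrite IHn addnACA. Qed.

Lemma vsize_eq0 n (x : vec n) : vsize x = 0 -> x = vzero.
Proof.
elim: n x => [|n IHn] /= [] // a x /= /eqP.
by rewrite addn_eq0 => /andP[/eqP-> /eqP/IHn->].
Qed.

Lemma vlex_total n (x y : vec n) : vlex x y \/ x = y \/ vlex y x.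
Proof.
elim: n x y => [|n IHn] /=; first by move=> [] []; right; left.
move=> [a x] [b y] /=; case: (ltngtP a b) => [lt|lt|->]; [by left; left | by right; right; left |].
by case: (IHn x y) => [lt|[->|lt]]; [left|right; left|right; right]; auto.
Qed.

Lemma vlexD n (x y z : vec n) : vlex x y -> vlex (vadd x z) (vadd y z).
Proof.
elim: n x y z => //= n IHn x y z [lt|[-> /IHn lt]]; [left|right; auto].
by rewrite ltn_add2r.
Qed.

Lemma vlex_min n (P : vec n -> Prop) :
  (exists x, P x) -> exists x, P x /\ forall y, P y -> ~ vlex y x.
Proof.
elim: n P => [|n IHn] P exP; first by case: exP => x Px; exists x; split=> // y _ [].
have [|a [Pa mina]] := @ex_is_min (fun a => exists x, P (a, x)).
  by case: exP => -[a x] Px; exists a, x.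
have [x [Px minx]] := IHn (fun x => P (a, x)) Pa.
exists (a, x); split=> // -[b y] Py /= [lt|[eb ltyx]].
  by have := mina b (ex_intro _ y Py); rewrite leqNgt lt.
by apply: (minx y) => //; rewrite -eb.
Qed.

(** * Monotone subsequences and Dickson's lemma *)

Lemma homo_ltn_leq (g : nat -> nat) :
  {homo g : i j / i < j} -> {homo g : i j / i <= j}.
Proof. by move=> gI i j; rewrite leq_eqVlt => /orP[/eqP->//|/gI/ltnW]. Qed.

Lemma homo_ltn_ge (g : nat -> nat) : {homo g : i j / i < j} -> forall i, i <= g i.
Proof. by move=> gI; elim=> // i IHi; apply: leq_ltn_trans IHi (gI _ _ _). Qed.

(** Each next index is one where [f] is minimal among all later ones, so no subsequent value is
    smaller. *)
Lemma nat_nondecreasing_subseq (f : nat -> nat) :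
  exists g : nat -> nat, {homo g : i j / i < j} /\ {homo f \o g : i j / i <= j}.
Proof.
have /functional_choice[h hP] N : exists i, N <= i /\ forall j, N <= j -> f i <= f j.
  have [|v [[i [le_Ni <-]] minv]] := @ex_is_min (fun v => exists i, N <= i /\ f i = v).
    by exists (f N), N.
  by exists i; split=> // j le_Nj; apply: minv; exists j.
pose g t := iter t (fun s => h s.+1) (h 0).
have gS t : g t < g t.+1 by have [] := hP (g t).+1.
have gI : {homo g : i j / i < j} by apply: homo_ltn => //; apply: ltn_trans.
exists g; split=> // i j le_ij /=; have le_g := homo_ltn_leq gI le_ij.
case: i le_ij le_g => [|i] le_ij le_g; first by apply: (hP 0).2.
by apply: (hP (g i).+1).2; apply: leq_trans le_g.
Qed.

Lemma dickson n (f : nat -> vec n) :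
  exists g : nat -> nat, {homo g : i j / i < j} /\
    forall i j, i <= j -> vle (f (g i)) (f (g j)).
Proof.
elim: n f => [|n IHn] f.
  by exists id; split=> // i j _; exists tt; case: (f j).
have [g1 [g1I f1]] := nat_nondecreasing_subseq (fun i => (f i).1).
have [g2 [g2I f2]] := IHn (fun i => (f (g1 i)).2).
exists (g1 \o g2); split=> [i j lt|i j le]; first by apply: g1I; apply: g2I.
have [z def_z] := f2 i j le.
exists ((f (g1 (g2 j))).1 - (f (g1 (g2 i))).1, z); rewrite /= -def_z subnKC -?surjective_pairing //.
by apply: (f1 (g2 i) (g2 j)); apply: homo_ltn_leq le.
Qed.

Definition vcongruence {n} (E : vec n -> vec n -> Prop) : Prop :=
  [/\ forall x, E x x, forall x y, E x y -> E y x,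
      forall x y z, E x y -> E y z -> E x z
    & forall x y z, E x y -> E (vadd x z) (vadd y z)].

(* Redei's theorem in its chain form.  A congruence is determined, among the
   congruences containing it, by the up-closed set of elements that are not
   lexicographically minimal in their class, and Dickson's lemma forbids strictly
   increasing sequences of up-closed sets. *)
Lemma vcongruence_acc n (E : nat -> vec n -> vec n -> Prop) :
  (forall i, vcongruence (E i)) ->
  (forall i j x y, i <= j -> E i x y -> E j x y) ->
  exists i, forall j x y, E j x y -> E i x y.
Proof.
move=> Econg Emono; apply: NNPP => no_stab.
pose red i w := exists2 w', vlex w' w & E i w w'.
(* [F i] yields a stage and a vector reducible there but not at stage [i]. If [x] and [y] are
   related at stage [j] but not at [i], the larger of their minimal representatives at stage [i] is
   such a vector. *)
have /functional_choice[F FP] i : exists p : nat * vec n,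
    [/\ i <= p.1, red p.1 p.2 & ~ red i p.2].
  apply: NNPP => noF; apply: no_stab.
  exists i => j x y Exy; apply: NNPP => nExy.
  have [Er Es Et Ea] := Econg i.
  have [a [Eia mina]] := vlex_min (ex_intro (E i x) x (Er x)).
  have [b [Eib minb]] := vlex_min (ex_intro (E i y) y (Er y)).
  have nred z c : E i z c -> (forall w, E i z w -> ~ vlex w c) -> ~ red i c.
    by move=> Ezc minc [w lt_w Ecw]; apply: (minc w) => //; apply: Et Ecw.
  have le_ij : i <= j.
    by rewrite leqNgt; apply/negP => lt_ji; apply: nExy; apply: Emono Exy; apply: ltnW.
  have [_ Ejs Ejt _] := Econg j.
  have Eab : E j a b.
    apply: (Ejt _ x); first by apply: Ejs; apply: Emono Eia.
    by apply: Ejt Exy _; apply: Emono Eib.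
  case: (vlex_total a b) => [lt|[eab|lt]].
  - apply: noF; exists (j, b); split=> //; last exact: nred Eib minb.
    by exists a => //; apply: Ejs.
  - by apply: nExy; apply: (Et _ a) => //; apply: Es; rewrite eab.
  - apply: noF; exists (j, a); split=> //; last exact: nred Eia mina.
    by exists b.
pose idx t := iter t (fun i => (F i).1) 0.
have idxI s t : s <= t -> idx s <= idx t.
  move=> /subnKC <-; elim: (t - s) => [|u IHu]; rewrite ?addn0 // addnS.
  by apply: leq_trans IHu _; case: (FP (idx (s + u))).
have [g [gI gP]] := dickson (fun t => (F (idx t)).2).
have [z def_z] := gP 0 1 isT.
(* The vector chosen at [g 0] is already reducible at stage [idx (g 1)], hence so is its translate,
   the vector chosen at [g 1]: a contradiction. *)
case: (FP (idx (g 1))) => _ _; apply; rewrite def_z.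
have [_ [w lt_w Ew] _] := FP (idx (g 0)).
have [_ _ _ Ea] := Econg (idx (g 1)).
exists (vadd w z); first exact: vlexD.
by apply: Ea; apply: Emono Ew; apply: (idxI (g 0).+1); apply: gI.
Qed.

(** * Sizes of related vectors for a congruence on [N^n] *)

Section VectorRelations.
Variables (n : nat) (E : vec n -> vec n -> Prop).
Hypothesis Econg : vcongruence E.

Definition vunion k l := exists x y, [/\ vsize x = k, vsize y = l & E x y].

Lemma dickson_pair (x y : nat -> vec n) :
  exists g : nat -> nat, {homo g : i j / i < j} /\
    forall i j, i <= j -> vle (x (g i)) (x (g j)) /\ vle (y (g i)) (y (g j)).
Proof.
have [g1 [g1I xP]] := dickson x; have [g2 [g2I yP]] := dickson (y \o g1).
exists (g1 \o g2); split=> [i j lt|i j le]; first by apply: g1I; apply: g2I.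
by split; [apply: xP; apply: homo_ltn_leq le | apply: yP].
Qed.

(** Dickson's lemma is applied to pairs with [y] arbitrarily long: comparable [x] of equal size
    coincide, so some [y] is related to a longer [y + r], which the hypothesis excludes. *)
Lemma vunion_bounded k :
  (forall x r, E x (vadd x r) -> r = vzero) -> exists b, upper_bound (vunion k) b.
Proof.
move=> canc; apply: NNPP => unb; have [_ Es Et _] := Econg.
have /functional_choice[F FP] t : exists p : vec n * vec n,
    [/\ vsize p.1 = k, t <= vsize p.2 & E p.1 p.2].
  apply: NNPP => noF; apply: unb; exists t.
  move=> l [x [y [sx sy Exy]]]; rewrite leqNgt; apply/negP => lt_tl.
  by apply: noF; exists (x, y); rewrite sy ltnW.
have [g [gI gP]] := dickson_pair (fun t => (F t).1) (fun t => (F t).2).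
pose t := (vsize (F (g 0)).2).+1.
have [[rx def_rx] [ry def_ry]] := gP 0 t isT.
have [s0 _ E0] := FP (g 0); have [st le_t Et'] := FP (g t).
have rx0 : rx = vzero by apply: vsize_eq0; move: st; rewrite def_rx vsizeD; lia.
rewrite rx0 vadd0 in def_rx.
have ry0 : ry = vzero.
  by apply: (canc (F (g 0)).2); rewrite -def_ry; apply: Et Et'; rewrite def_rx; apply: Es.
move: le_t; rewrite def_ry ry0 vadd0; have := homo_ltn_ge gI t; rewrite /t; lia.
Qed.

Variable rho : nat -> nat.
Hypothesis rhoP : forall k, is_max (vunion k) (rho k).
Hypothesis rho_incr : {homo rho : i j / i <= j}.

Lemma vunion_rho_growth : exists B, forall k, rho k.+1 <= rho k + B.
Proof.
apply: NNPP => unb; have [Er Es Et Ea] := Econg.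
have /functional_choice[F FP] t : exists p : vec n * vec n, exists k,
    [/\ vsize p.1 = k.+1, vsize p.2 = rho k.+1, E p.1 p.2 & rho k + t < rho k.+1].
  apply: NNPP => noF; apply: unb; exists t => k.
  rewrite leqNgt; apply/negP => lt; have [[x [y [sx sy Exy]]] _] := rhoP k.+1.
  by apply: noF; exists (x, y), k.
have [g [gI gP]] := dickson_pair (fun t => (F t).1) (fun t => (F t).2).
pose x t := (F (g t)).1; pose y t := (F (g t)).2.
have Exy t : E (x t) (y t) by have [k []] := FP (g t).
(* Along the chain the annihilator-like congruences [r ~ r' iff x t + r ~ x t + r']
   increase, hence are constant from some [i] on; this replaces cancellation. *)
pose G t r r' := E (vadd (x t) r) (vadd (x t) r').
have Gcong t : vcongruence (G t).
  split=> [r|r s|r s u|r s u]; [exact: Er|exact: Es|exact: Et|rewrite /G].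
  by rewrite !vaddA; apply: Ea.
have Gmono s t r r' : s <= t -> G s r r' -> G t r r'.
  move=> le; have [[z]] := gP _ _ le; rewrite -/(x s) -/(x t) /G => -> _ Grr.
  by rewrite -!vaddA (vaddC z r) (vaddC z r') !vaddA; apply: Ea.
have [i Gi] := vcongruence_acc Gcong Gmono.
have [ki [sxi _ _ _]] := FP (g i).
(* The jump of [rho] at [kj] exceeds [j >= rho ki.+1], which forces [ki < kj]: [x j] is strictly
   longer than [x i]. *)
pose j := i + rho ki.+1.
have le_ij : i <= j by rewrite leq_addr.
have [kj [sxj syj _ lt_j]] := FP (g j).
have lt_xij : vsize (x i) < vsize (x j).
  rewrite /x sxi sxj ltnS ltnNge; apply/negP => le_kji.
  have := @rho_incr kj.+1 ki.+1 le_kji.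
  by have := homo_ltn_ge gI j; have : rho ki.+1 <= j := leq_addl _ _; lia.
(* The jump of [rho] at [kt] then exceeds [vsize (y j)]. Replacing [y j] by [y i] costs at most that
   much, while the other side shrinks to size at most [kt]. *)
pose t := j + vsize (y j).
have le_jt : j <= t by rewrite leq_addr.
have [kt [sxt syt _ lt_t]] := FP (g t).
have [[r def_r] [r' def_r']] := gP _ _ le_jt.
rewrite -/(x j) -/(x t) in def_r; rewrite -/(y j) -/(y t) in def_r'.
have /Gi Gir : G j r r'.
  rewrite /G -def_r; apply: Et (Exy t) _; rewrite def_r'; apply: Ea; exact: Es.
have /(rhoP _).2 : vunion (vsize (vadd (x i) r)) (vsize (vadd (y i) r')).
  exists (vadd (x i) r), (vadd (y i) r'); split=> //; apply: Et Gir _; exact: Ea.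
have le_k : vsize (vadd (x i) r) <= kt.
  by rewrite -ltnS -sxt -/(x t) def_r !vsizeD ltn_add2r.
have := rho_incr le_k; move: syt lt_t; rewrite -/(y t) def_r' !vsizeD.
by have := homo_ltn_ge gI t; have : vsize (y j) <= t := leq_addl _ _; lia.
Qed.

End VectorRelations.

(** * Factorizations *)

Section Factorizations.
Context {H : Type} {mul : H -> H -> H} {one : H}.
Hypothesis monH : is_monoid mul one.
Hypothesis redH : reduced mul one.
Hypothesis atomicH : atomic mul one.
Hypothesis ucH : unit_cancellative mul one.

Local Notation prodH := (prodH mul one).
Local Notation factz := (factz mul one).
Local Notation Uk := (Uk mul one).
Local Notation Lset := (Lset mul one).

Lemma prodH_cat s t : prodH (s ++ t) = mul (prodH s) (prodH t).
Proof.
have [mulA [mul1 _]] := monH.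
by elim: s => /= [|a s IHs]; rewrite ?mul1 // IHs mulA.
Qed.

Lemma factz_cat s t : factz s -> factz t -> factz (s ++ t).
Proof. by move=> fs ft; apply/List.Forall_app. Qed.

(** [b = (b a) b] makes [b a] a unit, hence [1] as [H] is reduced; the one-sided inverse is
    two-sided. *)
Lemma mul_eq_one_unit a b : mul a b = one -> is_unit mul one a.
Proof.
have [mulA [mul1 mulr1]] := monH; move=> ab1; exists b; split=> //.
by apply: redH; apply: (@ucH b); right; rewrite -mulA ab1 mulr1.
Qed.

Lemma factz_prod_one s : factz s -> prodH s = one -> s = nil.
Proof. by case: s => //= a s /List.Forall_cons_iff[[nua _] _] /mul_eq_one_unit. Qed.

Lemma Uk_sym k l : Uk k l -> Uk l k.
Proof. by case=> a []; exists a. Qed.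

Lemma Uk_add k l k' l' : Uk k l -> Uk k' l' -> Uk (k + k') (l + l').
Proof.
move=> [_ [[s [fs [<- <-]]] [t [ft [<- pt]]]]].
move=> [_ [[s' [fs' [<- <-]]] [t' [ft' [<- pt']]]]].
exists (prodH (s ++ s')); split.
  by exists (s ++ s'); rewrite size_cat; split; first exact: factz_cat.
exists (t ++ t'); rewrite size_cat !prodH_cat pt pt'; split=> //; exact: factz_cat.
Qed.

Lemma Uk_0 l : Uk 0 l -> l = 0.
Proof.
move=> [_ [[s [_ [/size0nil-> <-]]] [t [ft [<- pt]]]]].
by rewrite (factz_prod_one ft pt).
Qed.

Hypothesis ntH : exists x : H, x <> one.

Lemma ex_atom : exists a, is_atom mul one a.
Proof.
have [x x1] := ntH.
have [|s [nil_s [fs _]]] := @atomicH x; first by move/redH.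
by case: s fs nil_s => // a s /List.Forall_cons_iff[]; exists a.
Qed.

Lemma Uk_refl k : Uk k k.
Proof.
have [a ha] := ex_atom; pose s := nseq k a.
suff La : Lset (prodH s) k by exists (prodH s).
exists s; rewrite size_nseq; split=> //.
by rewrite /s; elim: k {s} => //= k IHk; constructor.
Qed.

Definition unions_bounded_growth : Prop :=
  exists rho : nat -> nat, (forall k, is_max (Uk k) (rho k)) /\
    exists B, forall k, rho k.+1 <= rho k + B.

Lemma unions_bounded_growthW : unions_bounded_growth ->
  (exists M : nat, (0 < M)%N /\ forall k : nat, (2 <= k)%N ->
     ele (rho_k mul one k) (eadd (rho_k mul one k.-1) M)) /\
  structure_thm_unions mul one.
Proof.
move=> [rho [rhoP [B rhoS]]]; split.
  (* The successor ensures [0 < M]. *)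
  exists B.+1; split=> // -[//|k] _ /=; rewrite /rho_k !(esup_is_max (rhoP _)) /=.
  by have := rhoS k; lia.
apply: (@U_AAP _ rho B) => //; [exact: Uk_refl | exact: Uk_sym | exact: Uk_add |].
by apply: Uk_0; apply: (rhoP 0).1.
Qed.

(* [n / m] is an accepted elasticity. *)
Lemma unions_growth_accepted m n : 0 < m -> Uk m n ->
  (forall k l, Uk k l -> l * m <= n * k) -> unions_bounded_growth.
Proof.
move=> m_gt0 Umn Ule.
have /functional_choice[rho rhoP] k : exists s, is_max (Uk k) s.
  apply: (@ex_is_max _ (n * k)).
    by exists k; apply: Uk_refl.
  by move=> l /Ule; apply: leq_trans; apply: leq_pmulr.
exists rho; split=> //; exists n => k.
(* With [k = q m + r], [q] copies of [(m, n)] give [rho k >= q n], whereas [k + 1 <= (q + 1) m]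
   gives [rho (k + 1) <= (q + 1) n]. *)
have /(rhoP _).2 : Uk k (k %/ m * n + k %% m).
  rewrite {1}(divn_eq k m); apply: Uk_add; last exact: Uk_refl.
  elim: (k %/ m) => [|q IHq]; first by rewrite !mul0n; apply: Uk_refl.
  by rewrite !mulSn; apply: Uk_add.
have := Ule _ _ (rhoP k.+1).1; have := ltn_pmod k m_gt0.
have := divn_eq k m; set q := k %/ m; set r := k %% m => -> lt_rm le1 le2.
suff : rho (q * m + r).+1 <= q * n + n by lia.
rewrite -(leq_pmul2r m_gt0); apply: leq_trans le1 _.
by rewrite -mulSnr -mulnA mulnCA leq_mul2l mulSnr; lia.
Qed.

Lemma growth_of_accepted_elasticity :
  elasticity_accepted_finite mul one -> unions_bounded_growth.
Proof.
move=> [a [q [rho_a le_q]]].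
suff [m [n [m_gt0 Umn q_eq]]] :
    exists m n, [/\ 0 < m, Uk m n & q = (n%:R / m%:R)%R :> rat].
  apply: (unions_growth_accepted m_gt0 Umn) => k l [b [Lk Ll]].
  have [k0|k_gt0] := posnP k.
    by rewrite (@Uk_0 l) //; exists b; rewrite -k0.
  have [l0|l_gt0] := posnP l; first by rewrite l0.
  have := le_q b; rewrite /rhoL; case: excluded_middle_informative => [exL|[]]; last by exists k.
  case sup_eq: esup => [s|//]; have [v [[Lv v_gt0] min_v]] := ex_is_min exL.
  rewrite (emin_is_min (conj (conj Lv v_gt0) min_v)) q_eq /=.
  rewrite ler_pdivrMr ?ltr0n // mulrAC ler_pdivlMr ?ltr0n // -!natrM ler_nat => le_s.
  have le_ls : l <= s by apply: (esup_upper sup_eq).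
  have le_vk : v <= k by apply: min_v.
  apply: leq_trans (leq_mul le_ls (leqnn m)) _; apply: leq_trans le_s _.
  by rewrite leq_mul2l le_vk orbT.
move: rho_a; rewrite /rhoL; case: excluded_middle_informative => [exL|_ [<-]]; last first.
  (* Without a positive length [rhoL] takes its default value [1], realized as the ratio [1 / 1]. *)
  by exists 1, 1; split=> //; apply: Uk_refl.
have [v vP] := ex_is_min exL; rewrite (emin_is_min vP).
case sup_eq: esup => [s|//] [<-].
have [s' sP] := ex_is_max exL (esup_upper sup_eq).
move: sup_eq; rewrite (esup_is_max sP) => -[<-].
exists v, s'; split=> //; first by have [[]] := vP.
by exists a; split; [have [[]] := vP | have [[]] := sP].
Qed.

(** Lengths add up along a product of generating relations, and a mediant of fractions never exceeds
    the largest of them. *)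
Lemma growth_of_relations_fin_gen :
  relations_fin_gen mul one -> unions_bounded_growth.
Proof.
move=> [G [simG genG]].
have size_Zeq x y : Zeq mul x y -> size x = size y.
  move=> [permE eqE]; case: (classic (comm_monoid mul)) => [/permE|/eqE->//].
  exact: Permutation_length.
have UG g : List.In g G -> Uk (size g.1) (size g.2).
  move=> Gg; have /List.Forall_forall/(_ g Gg)[f1 [f2 eq12]] := simG.
  by exists (prodH g.1); split; [exists g.1 | exists g.2].
have maxG : exists m n, [/\ 0 < m, Uk m n &
    forall g, List.In g G -> size g.2 * m <= n * size g.1].
  elim: G UG {simG genG} => [|g G IHG] UG; first by exists 1, 1; split=> //; apply: Uk_refl.
  have [|m [n [m_gt0 Umn le_mn]]] := IHG; first by move=> h Gh; apply: UG; right.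
  have Ug : Uk (size g.1) (size g.2) by apply: UG; left.
  have [le_g|lt_g] := leqP (size g.2 * m) (n * size g.1).
    by exists m, n; split=> // h [<-|/le_mn].
  (* An empty first component would force an empty second one by [Uk_0], so the new denominator is
     positive. *)
  have g1_gt0 : 0 < size g.1.
    by rewrite lt0n; apply/negP => /eqP g10; rewrite g10 in Ug lt_g; rewrite (Uk_0 Ug) in lt_g.
  exists (size g.1), (size g.2); split=> // h [<-|/le_mn le_h]; first by rewrite leqnn.
  rewrite -(leq_pmul2r m_gt0); nia.
have [m [n [m_gt0 Umn le_mn]]] := maxG.
apply: (unions_growth_accepted m_gt0 Umn) => k l [a [[x [fx [<- px]]] [y [fy [<- py]]]]].
have [|s [sG [/size_Zeq-> /size_Zeq->]]] := genG x y; first by split=> //; rewrite /= px.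
elim: s sG => [|g s IHs] /=; first by rewrite mul0n.
move=> /List.Forall_cons_iff[/le_mn le_g /IHs le_s].
by rewrite !size_cat mulnDl mulnDr leq_add.
Qed.

(** * Finitely generated commutative monoids *)

Section Commutative.
Hypothesis mulC : comm_monoid mul.

(** The canonical map to [H] from the free abelian monoid on [s], whose elements are exponent
    vectors. *)
Fixpoint veval (s : seq H) : vec (size s) -> H :=
  match s with
  | nil => fun _ => one
  | g :: s' => fun x => mul (iter x.1 (mul g) one) (veval x.2)
  end.

Lemma veval0 s : veval (vzero : vec (size s)) = one.
Proof. by have [_ [mul1 _]] := monH; elim: s => //= g s ->; rewrite mul1. Qed.

Lemma vevalD s (x y : vec (size s)) : veval (vadd x y) = mul (veval x) (veval y).
Proof.
have [mulA [mul1 _]] := monH.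
have powD g a b : iter (a + b) (mul g) one = mul (iter a (mul g) one) (iter b (mul g) one).
  by elim: a => [|a IHa] /=; rewrite ?mul1 // IHa mulA.
elim: s x y => [|g s IHs] x y /=; first by rewrite mul1.
rewrite IHs powD -!mulA; congr mul.
by rewrite mulA (mulC _ (veval x.2)) -mulA.
Qed.

Lemma veval_congruence s : vcongruence (fun x y : vec (size s) => veval x = veval y).
Proof. by split=> [|x y ->|x y z -> ->|x y z] //; rewrite !vevalD => ->. Qed.

Lemma veval_word s w : List.Forall (fun a => List.In a s) w ->
  exists x : vec (size s), vsize x = size w /\ veval x = prodH w.
Proof.
have [mulA [mul1 mulr1]] := monH.
elim: w => [_|a w IHw /List.Forall_cons_iff[sa /IHw[x [sx ex]]]].
  by exists vzero; rewrite veval0; split=> //; elim: (size s).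
suff [e [se ee]] : exists e : vec (size s), vsize e = 1 /\ veval e = a.
  by exists (vadd e x); rewrite vsizeD se sx vevalD ee ex.
elim: s sa {x sx ex IHw} => //= g s IHs [->|/IHs[e [se ee]]].
  by exists (1, vzero); rewrite /= veval0 !mulr1; split=> //; elim: (size s).
by exists (0, e); rewrite /= ee mul1.
Qed.

Lemma word_veval s (x : vec (size s)) : factz s ->
  exists w, [/\ factz w, size w = vsize x & prodH w = veval x].
Proof.
elim: s x => [|g s IHs] x /=; first by exists nil; split=> //; constructor.
move=> /List.Forall_cons_iff[ag /(IHs x.2)[w [fw sw pw]]].
exists (nseq x.1 g ++ w); rewrite size_cat size_nseq sw prodH_cat pw; split=> //.
  by apply: factz_cat => //; elim: x.1 => //= k IHk; constructor.
by congr mul; elim: x.1 => //= k ->.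
Qed.

(** When an atom is written as a word in generators, all factors but one are units, hence [1]; so
    the atom is itself a generator. *)
Lemma fin_generated_atoms : fin_generated mul one ->
  exists s, forall a, is_atom mul one a <-> List.In a s.
Proof.
have [_ [mul1 mulr1]] := monH; move=> [gens genH].
pose atomb a := if excluded_middle_informative (is_atom mul one a) then true else false.
exists (List.filter atomb gens) => a; rewrite List.filter_In /atomb.
case: excluded_middle_informative => [at_a|nat_a]; last by split=> // -[].
split=> // _; split=> //; have [w [gw pw]] := genH a.
have [nua at_aP] := at_a.
elim: w gw pw => [_ /= a1|g w IHw /List.Forall_cons_iff[gg gw] /= pw].
  by case: nua; exists one; rewrite -a1 mul1.
case: (at_aP g (prodH w)) => [//|/redH g1|/redH w1].
  by apply: IHw => //; rewrite -pw g1 mul1.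
by rewrite -pw w1 mulr1.
Qed.

Lemma growth_of_fin_generated : fin_generated mul one -> unions_bounded_growth.
Proof.
move=> /fin_generated_atoms[s sP].
have fs : factz s by apply/List.Forall_forall => a /sP.
pose E (x y : vec (size s)) := veval x = veval y.
have UE k l : Uk k l <-> vunion E k l.
  split=> [[a [[w [fw [<- pw]]] [w' [fw' [<- pw']]]]]|[x [y [<- <- Exy]]]].
    have sub v : factz v -> List.Forall (fun b => List.In b s) v.
      by apply: List.Forall_impl => b /sP.
    have [x [sx ex]] := veval_word (sub _ fw); have [y [sy ey]] := veval_word (sub _ fw').
    by exists x, y; split; rewrite // /E ex ey pw.
  have [w [fw sw pw]] := word_veval x fs; have [w' [fw' sw' pw']] := word_veval y fs.
  by exists (veval x); split; [exists w | exists w'; rewrite Exy].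
have /functional_choice[rho rhoP] k : exists s, is_max (vunion E k) s.
  have [|b ub] := vunion_bounded (veval_congruence s) k _; last first.
    by apply: ex_is_max ub; exists k; apply/UE; apply: Uk_refl.
  (* Unit-cancellation turns [veval x = mul (veval x) (veval r)] into [veval r = one], and only the
     empty word of atoms has product [one]. *)
  move=> x r; rewrite vevalD => xr; apply: vsize_eq0.
  have [w [fw <- pw]] := word_veval r fs.
  rewrite (factz_prod_one fw) //; apply: redH; apply: (@ucH (veval x)); left.
  by rewrite pw.
have rho_incr : {homo rho : i j / i <= j}.
  move=> i j le_ij; apply: leq_trans (leq_addr (j - i) _) _; apply: (rhoP j).2; apply/UE.
  by rewrite -{1}(subnKC le_ij); apply: Uk_add; [apply/UE; apply: (rhoP i).1 | apply: Uk_refl].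
exists rho; split=> [k|]; last exact: (vunion_rho_growth (veval_congruence s) rhoP rho_incr).
by split=> [|l /UE]; [apply/UE; apply: (rhoP k).1 | apply: (rhoP k).2].
Qed.

End Commutative.
End Factorizations.

Unset Implicit Arguments.

Theorem theorem3p6 (H : Type) (mul : H -> H -> H) (one : H) :
  is_monoid mul one ->
  (exists x : H, x <> one) ->
  reduced mul one ->
  atomic mul one ->
  unit_cancellative mul one ->
  ((fin_presented mul one /\ elasticity_accepted_finite mul one)
   \/ (cancellative mul /\ relations_fin_gen mul one)
   \/ (comm_monoid mul /\ fin_generated mul one)) ->
  (exists M : nat, (0 < M)%N /\
     forall k : nat, (2 <= k)%N ->
       ele (rho_k mul one k) (eadd (rho_k mul one k.-1) M)) /\
  structure_thm_unions mul one.
Proof.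
move=> monH ntH redH atomicH ucH hyp.
apply: unions_bounded_growthW => //.
case: hyp => [[_ acc]|[[_ rfg]|[mulC fg]]].
- exact: growth_of_accepted_elasticity.
- exact: growth_of_relations_fin_gen.
- exact: growth_of_fin_generated.
Qed.
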